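(* Let $q$ be a prime power, let $G=\mathrm{PGL}(2,q)$, and let $D$ be a dihedral subgroup of $G$ of order $2(q+1)$. Set \[ A=\{g\in G:\ g^{q+1}=1,\ g^2\neq 1\}. \] Then $A\cdot D=\lambda G$, where $\lambda=q$ if $q$ is even and $\lambda=q-1$ if $q$ is odd.
   Context: For subsets $A,B$ of a finite group $G$ and a natural number $\lambda$, the notation $A\cdot B=\lambda G$ (equivalently $\lambda G=A\cdot B$) means that the multiset $\{ab:\ a\in A,\ b\in B\}$ covers each element of $G$ exactly $\lambda$ times; i.e. for every $g\in G$ there are exactly $\lambda$ pairs $(a,b)\in A\times B$ with $ab=g$. $\mathrm{PGL}(2,q)$ is the quotient of $\mathrm{GL}(2,q)$ by its subgroup of scalar matrices. A dihedral group of order $2n$ is the group $\langle x,y \mid x^n=y^2=1,\ yxy^{-1}=x^{-1}\rangle$. *)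

(* Defs.v *)
From mathcomp Require Import all_boot all_order all_fingroup all_algebra.
From mathcomp Require Import all_solvable.

Set Implicit Arguments.
Unset Strict Implicit.
Unset Printing Implicit Defensive.

Local Open Scope group_scope.

Definition GLscalar (n : nat) (F : finFieldType) : {set {'GL_n[F]}} :=
  [set u | is_scalar_mx (GLval u)].

Lemma GLscalar_group_set (n : nat) (F : finFieldType) :
  group_set (GLscalar n F).
Proof.
apply/group_setP; split=> [|u v]; rewrite !inE.
  by rewrite GL_1E scalar_mx_is_scalar.
case/is_scalar_mxP=> a ua /is_scalar_mxP[b vb].
by rewrite GL_ME ua vb -mulmxE -scalar_mxM scalar_mx_is_scalar.
Qed.

Canonical GLscalar_group (n : nat) (F : finFieldType) :=
  Group (GLscalar_group_set n F).

(* Normality matters for [PGL] below: the library's [A / H] only retains the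
   elements of [A] that normalise [H]. *)
Lemma GLscalar_normal (n : nat) (F : finFieldType) : GLscalar n F <| 'GL_n[F].
Proof.
rewrite /normal; apply/andP; split; first by apply/subsetP=> u _; rewrite inE.
apply/subsetP=> v _; rewrite inE; apply/subsetP=> _ /imsetP[u uZ ->].
suff -> : u ^ v = u by [].
move: uZ; rewrite inE => /is_scalar_mxP[a ua].
apply/conjg_fixP/commgP/val_inj.
change (GLval u *m GLval v = GLval v *m GLval u)%R.
by rewrite ua scalar_mxC.
Qed.

Definition PGL (n : nat) (F : finFieldType) : {set coset_of (GLscalar n F)} :=
  'GL_n[F] / GLscalar n F.

Canonical PGL_group (n : nat) (F : finFieldType) := [group of PGL n F].

(* A . B = lambda G, where A and B are understood to be subsets of G. *)
Definition covers_exactly (gT : finGroupType) (A B : {set gT}) (lambda : nat)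
    (G : {set gT}) : Prop :=
  forall g, g \in G -> #|[set ab in setX A B | ab.1 * ab.2 == g]| = lambda.

(* Main.v *)
(* An element of PGL(2,q) lies in A iff a lift M satisfies M^2 = t M - d with
   t <> 0 and x^2 - t x + d irreducible. The cyclic half T of D is K^*/F^* for
   a field K = F[X] with X^2 = X - d. When g is not in D, the coset g D contains
   the class of a matrix 1 + Y, where Y in D \ T satisfies Y X = (1 - X) Y and
   Y^2 = eta is a scalar other than 0 and 1. For z in K of trace t and norm n,
   N = (1 + Y) z satisfies N^2 = t N - (1 - eta) n, so the elements of the coset
   of T lying in A correspond to the points z of the line t = 1 for which
   x^2 - x + (1 - eta) n has no root in F. The coset of the other half of D
   gives the same count with 1/eta instead of eta, as (1 + Y) Y = eta (1 + Y/eta).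
   The pairs (z, x) with x a root form the affine conic n = eta, which has q + 1
   points, minus its points of trace 0. These and the double roots are what makes
   either count irregular, but in odd characteristic the points of trace 0 for
   eta are as many as the double roots for 1/eta, so the two counts add up to
   q - 1; for q even they add up to q. *)
Require Import Defs.
From mathcomp Require Import all_boot all_order all_fingroup all_algebra.
From mathcomp Require Import all_solvable.
From mathcomp Require Import finfield galois ring zify.

Set Implicit Arguments.
Unset Strict Implicit.
Unset Printing Implicit Defensive.

Import GRing.Theory.

Local Open Scope group_scope.
Local Open Scope ring_scope.

(** * Counting values of the norm form *)

Lemma finField_pchar_nat (F : finFieldType) : [pchar F].-nat #|F|.
Proof.
have [p p_pr pcharF] := finPcharP F.
rewrite (eq_pnat _ (pcharf_eq pcharF)) -cardsT.
have /and3P[] := fin_ring_pchar_abelem pcharF.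
by [].
Qed.

Lemma finField_natf0 (F : finFieldType) : #|F|%:R = 0 :> F.
Proof.
have [p p_pr pcharF] := finPcharP F.
have := finField_pchar_nat F.
rewrite (eq_pnat _ (pcharf_eq pcharF)) => /p_natP[[|n] oF].
  by have := finNzRing_gt1 F; rewrite oF.
by rewrite oF expnS natrM (pcharf0 pcharF) mul0r.
Qed.

Lemma odd_card_finField (F : finFieldType) : odd #|F| = (2%:R != 0 :> F).
Proof.
apply/idP/idP => [oddF | F2].
  apply/eqP => F2.
  have := finField_natf0 F; rewrite -(odd_double_half #|F|) oddF -muln2.
  by rewrite natrD natrM F2 mulr0 addr0 => /eqP; rewrite oner_eq0.
have [p p_pr pcharF] := finPcharP F.
have := finField_pchar_nat F.
rewrite (eq_pnat _ (pcharf_eq pcharF)) => /p_natP[n ->].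
rewrite oddX; apply/orP; right; case: (even_prime p_pr) => // p2.
by rewrite -p2 (pcharf0 pcharF) eqxx in F2.
Qed.

Section NormForm.
Variables (F : finFieldType) (d : F).
Hypothesis irr_d : forall x : F, x ^+ 2 - x + d != 0.

(** The norm of [u.1 + u.2 t] for a root [t] of [x^2 - x + d]. Giving [t] trace 1 lets all
    characteristics be treated alike. *)
Definition nform (u : F * F) : F := u.1 ^+ 2 + u.1 * u.2 + d * u.2 ^+ 2.

Lemma nform_eq0 u : (nform u == 0) = (u == 0).
Proof.
case: u => a b; rewrite /nform /= xpair_eqE; have [->|b0] := eqVneq b 0.
  by rewrite mulr0 expr0n mulr0 !addr0 expf_eq0 andbT.
rewrite andbF; apply/negbTE.
have -> : a ^+ 2 + a * b + d * b ^+ 2 = b ^+ 2 * ((- a / b) ^+ 2 - (- a / b) + d).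
  by field.
by rewrite mulf_neq0 ?expf_neq0.
Qed.

(* Over a field containing a root [t] of [x^2 - x + d] the form factors as
   [(a + b t) (a + b t^q) = (a + b t)^(q + 1)]. *)
Lemma nform_fibre_le (c : F) : (#|[set u | nform u == c]| <= #|F|.+1)%N.
Proof.
pose p : {poly F} := 'X^2 - 'X + d%:P.
have szp : size p = 3%N.
  rewrite /p -addrA size_polyDl size_polyXn //.
  rewrite (leq_ltn_trans (size_polyD _ _)) // gtn_max size_polyN size_polyX.
  by rewrite (leq_ltn_trans (size_polyC_leq1 _)).
have p0 : p != 0 by rewrite -size_poly_eq0 szp.
have [L [zs pzs _]] := FinSplittingFieldFor p0.
pose i : {rmorphism F -> L} := in_alg L.
have [t pt] : exists t : L, t ^+ 2 - t + i d = 0.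
  case: zs pzs => [|t zs] pzs.
    by move/eqp_size: pzs; rewrite big_nil size_poly1 size_map_poly szp.
  exists t; apply/eqP; have: root (map_poly i p) t.
    by rewrite (eqp_root pzs) root_prod_XsubC inE eqxx.
  by rewrite /p rmorphD rmorphB /= map_polyXn map_polyX map_polyC /root !hornerE.
have iq x : i x ^+ #|F| = i x by rewrite -rmorphXn expf_card.
have pchL : [pchar L].-nat #|F|.
  by rewrite (eq_pnat _ (pchar_lalg L)) finField_pchar_nat.
have tF x : t != i x.
  apply: contraNneq (irr_d x) => tx; apply/eqP/(fmorph_inj i).
  by rewrite rmorph0 -[RHS]pt tx rmorphD rmorphB rmorphXn.
have t2 : t ^+ 2 = t + i (- d).
  by rewrite rmorphN; apply/eqP; rewrite -subr_eq0 -pt; apply/eqP; ring.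
(* Frobenius permutes the two roots [t] and [1 - t]. It cannot fix [t], since the roots of
   ['X^#|F| - 'X] are the elements of [F]. *)
have tq : t ^+ #|F| = 1 - t.
  pose s := t ^+ #|F|.
  have ps : s ^+ 2 - s + i d = 0.
    rewrite -exprM mulnC exprM t2 exprDn_pchar // iq -/s rmorphN.
    by ring.
  have: (s - t) * (s + t - 1) = 0.
    have -> : (s - t) * (s + t - 1) = (s ^+ 2 - s + i d) - (t ^+ 2 - t + i d) by ring.
    by rewrite ps pt subrr.
  move/eqP; rewrite mulf_eq0 => /orP[|/eqP E]; last first.
    by apply/eqP; rewrite -subr_eq0 -E; apply/eqP; rewrite -/s; ring.
  rewrite subr_eq0 => /eqP st.
  have: root ('X^#|F| - 'X : {poly L}) t by rewrite /root !hornerE -/s st subrr.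
  have -> : 'X^#|F| - 'X = map_poly i ('X^#|F| - 'X).
    by rewrite rmorphB /= map_polyXn map_polyX.
  rewrite finField_genPoly rmorph_prod /=.
  under eq_bigr => x _ do rewrite rmorphB /= map_polyX map_polyC.
  rewrite -(big_map i xpredT (fun z => 'X - z%:P)) root_prod_XsubC.
  by case/mapP => x _ /eqP; rewrite (negbTE (tF x)).
pose e (u : F * F) := i u.1 + i u.2 * t.
have e_inj : injective e.
  move=> [a b] [a' b'] /= /eqP; rewrite /e /= -subr_eq0.
  have -> : i a + i b * t - (i a' + i b' * t) = i (a - a') - i (b' - b) * t.
    by rewrite !rmorphB /=; ring.
  rewrite subr_eq0; have [->|bb] := eqVneq b' b.
    rewrite subrr rmorph0 mul0r fmorph_eq0 subr_eq0 => /eqP->//.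
  have bb0 : i (b' - b) != 0 by rewrite fmorph_eq0 subr_eq0.
  rewrite eq_sym => /eqP E; case/eqP: (tF ((a - a') / (b' - b))).
  by apply: (mulfI bb0); rewrite E -rmorphM mulrC divfK // subr_eq0.
have e_norm u : e u ^+ #|F|.+1 = i (nform u).
  rewrite exprS /e exprDn_pchar // exprMn !iq tq /nform.
  have did : i d = t - t ^+ 2 by rewrite t2 rmorphN; ring.
  have -> : i (u.1 ^+ 2 + u.1 * u.2 + d * u.2 ^+ 2)
            = i u.1 ^+ 2 + i u.1 * i u.2 + i d * i u.2 ^+ 2 by ring.
  by rewrite did; ring.
have: (size [seq e u | u <- enum [set u | nform u == c]] < size ('X^(#|F|.+1) - (i c)%:P)%R)%N.
  apply: max_poly_roots.
  - by rewrite -size_poly_eq0 size_XnsubC.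
  - apply/allP => x /mapP[u]; rewrite mem_enum inE => /eqP uc ->.
    by rewrite /root !hornerE e_norm uc subrr.
  - by rewrite map_inj_uniq ?enum_uniq.
by rewrite size_map -cardE size_XnsubC.
Qed.

(** The [q^2] points split into one of norm 0 and at most [q + 1] over each of the [q - 1] other
    values. As [1 + (q - 1)(q + 1) = q^2], every bound is attained. *)
Lemma card_nform_fibre (c : F) : c != 0 -> #|[set u | nform u == c]| = #|F|.+1.
Proof.
move=> c0; apply/eqP; rewrite eqn_leq nform_fibre_le /= leqNgt; apply/negP => lt_c.
have F0 : (0 < #|F|)%N by rewrite (ltn_trans _ (finNzRing_gt1 F)).
suff: (#|F| ^ 2 < 1 + #|F|.-1 * #|F|.+1)%N.
  by case: #|F| F0 => // n _; rewrite mulnS mulnC addnA add1n -mulnS mulnn ltnn.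
rewrite -mulnn -card_prod -sum1_card (partition_big nform predT) //=.
rewrite (bigD1 0) //= -addnS leq_add //.
  rewrite sum1dep_card -(cards1 (0 : F * F)) subset_leq_card //.
  by apply/subsetP => u; rewrite !inE nform_eq0.
rewrite (bigD1 c) //= -addSn.
have -> : (#|F|.-1 * #|F|.+1 = #|F|.+1 + \sum_(k : F | (k != 0%R) && (k != c)) #|F|.+1)%N.
  rewrite sum_nat_const -mulSn; congr (_ * _)%N.
  rewrite (cardD1 0) inE /= (cardD1 c) !inE c0 /= add1n; congr _.+1.
  by apply: eq_card => k; rewrite !inE andbC andbT.
apply: leq_add; first by rewrite sum1dep_card.
by apply: leq_sum => k _; rewrite sum1dep_card nform_fibre_le.
Qed.

(** * Roots of the quadratics attached to the line of trace 1 *)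

Definition nform_disc : F := 1 - 4 * d.

(* The value of [nform] at the point [(s, 1 - 2 s)] of the line [2 a + b = 1]. *)
Definition lform (s : F) : F := d + (1 - 4 * d) * (s - s ^+ 2).

Definition rootless (m : F) := [forall x : F, x ^+ 2 - x + m != 0].

(* The number of points of a coset of the torus that lie in A, see
   [card_torus_coset]. *)
Definition nrootless (eta : F) := #|[set s | rootless ((1 - eta) * lform s)]|.

(** This measures the irregularity of the count: the points of trace 0 on the conic and, in odd
    characteristic, the double roots are both counted by values of [nsqrt]. *)
Definition nsqrt (k : F) := #|[set b : F | k * b ^+ 2 == 1]|.

Lemma lform_neq0 s : lform s != 0.
Proof.
have -> : lform s = nform (s, 1 - 2 * s) by rewrite /lform /nform /=; ring.
rewrite nform_eq0 xpair_eqE; apply/negP => /andP[/eqP-> /eqP].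
by move/eqP; rewrite mulr0 subr0 oner_eq0.
Qed.

(** A root [x] over a point [z] of trace 1 corresponds to the point [z / x], of trace [1 / x], on a
    conic with [q + 1] points. Only the conic's points of trace 0 are missed. *)
Lemma card_conic (eta : F) : eta != 0 -> eta != 1 ->
  (#|[set u : F * F | (u.2 ^+ 2 - u.2 + (1 - eta) * lform u.1 == 0)%R]|
    + nsqrt ((1 - eta) * nform_disc)%R = #|F|.+1)%N.
Proof.
move=> eta0 eta1; set k : F := 1 - eta.
have k0 : k != 0 by rewrite subr_eq0 eq_sym.
(* The substitution [z -> k z - 1] carries [B] to the fibre of norm [eta], because
   [n(k z - 1) = k^2 n(z) - k tr(z) + 1]. *)
pose B := [set z : F * F | 1 - (2 * z.1 + z.2) + k * nform z == 0].
have <- : #|B| = #|F|.+1.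
  rewrite -(card_nform_fibre eta0).
  pose f (z : F * F) : F * F := (k * z.1 - 1, k * z.2).
  have f_inj : injective f.
    move=> [a b] [a' b'] [] /addIr/(mulfI k0)-> /(mulfI k0)-> //.
  rewrite -(card_imset _ f_inj); apply: eq_card => -[a b]; rewrite !inE.
  apply/imsetP/idP => [[[a' b']] | ab].
    rewrite inE /= => /eqP E [-> ->]; rewrite -subr_eq0; apply/eqP.
    transitivity (k * (1 - (2 * a' + b') + k * nform (a', b'))).
      by rewrite /nform /k /=; ring.
    by rewrite E mulr0.
  exists ((a + 1) / k, b / k); last by congr pair; rewrite mulrC divfK // addrK.
  rewrite inE; apply/eqP/(mulfI k0); rewrite mulr0.
  transitivity (nform (a, b) - eta).
    by rewrite /nform /= (_ : eta = 1 - k); [field | rewrite /k; ring].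
  by rewrite (eqP ab) subrr.
rewrite -(cardsID [set z : F * F | 2 * z.1 + z.2 != 0] B); congr (_ + _)%N.
  pose f (u : F * F) : F * F := (u.1 / u.2, (1 - 2 * u.1) / u.2).
  have x0 (s x : F) : x ^+ 2 - x + k * lform s == 0 -> x != 0.
    apply: contraTneq => ->.
    by rewrite expr0n oppr0 !add0r mulf_neq0 ?lform_neq0.
  have tr1 (s x : F) : x != 0 -> 2 * (s / x) + (1 - 2 * s) / x = x^-1 by move=> ?; field.
  rewrite -(card_in_imset (f := f)); last first.
    move=> [s x] [s' x']; rewrite !inE /= => /x0 xn0 /x0 xn0'.
    rewrite /f /= => -[E1 E2].
    have xx : x = x' by apply: invr_inj; rewrite -(tr1 s) // E1 E2 tr1.
    by congr pair => //; move: E1; rewrite xx; apply/mulIf; rewrite invr_eq0.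
  apply: eq_card => -[a b]; rewrite !inE /=; apply/imsetP/andP.
    case=> -[s x]; rewrite inE /= => E [-> ->]; have xn0 := x0 _ _ E.
    split; last by rewrite tr1 // invr_eq0.
    apply/eqP/(mulfI (expf_neq0 2 xn0)); rewrite mulr0 -(eqP E).
    by rewrite /nform /lform /k /=; field.
  case=> E t0; exists (a / (2 * a + b), (2 * a + b)^-1); last first.
    by congr pair; rewrite /=; field; rewrite t0 ?oner_eq0.
  rewrite inE /=; apply/eqP/(mulfI (expf_neq0 2 t0)); rewrite mulr0 -(eqP E).
  by rewrite /nform /lform /=; field.
(* On the points of trace 0 the norm is [- nform_disc * a ^+ 2], so the conic's equation becomes the
   one counted by [nsqrt]. *)
pose f (a : F) : F * F := (a, - (2 * a)).
have f_inj : injective f by move=> a a' [].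
rewrite /nsqrt -(card_imset _ f_inj); apply: eq_card => -[a b]; rewrite !inE negbK.
apply/imsetP/andP => [[a']|[/eqP ab0 /eqP E]].
  rewrite inE => /eqP E [-> ->]; split; first by rewrite /= subrr.
  rewrite -[X in X - _]E /nform /= /nform_disc; apply/eqP; ring.
have b2 : b = - (2 * a) by apply/eqP; rewrite -addr_eq0 addrC ab0.
exists a; last by rewrite b2.
rewrite inE eq_sym -subr_eq0 -E /nform /= b2 /nform_disc; apply/eqP; ring.
Qed.

(** The roots are [r] and [1 - r], which may coincide. Counting a double root twice gives an
    identity free of cases, ready to be summed. *)
Lemma rootless_count m :
  ((rootless m).*2 + #|[set x : F | x ^+ 2 - x + m == 0]%R|
    + (#|[set x : F | x ^+ 2 - x + m == 0]%R| == 1%N) = 2)%N.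
Proof.
set R := [set x | _].
have [/forallP rm | ] := boolP (rootless m).
  rewrite (_ : R = set0) ?cards0 //; apply/setP => x.
  by rewrite !inE (negbTE (rm x)).
rewrite negb_forall => /existsP[r]; rewrite negbK => /eqP mr.
have -> : R = [set r; 1 - r].
  apply/setP => x; rewrite !inE.
  have -> : x ^+ 2 - x + m = (x - r) * (x - (1 - r)) + (r ^+ 2 - r + m) by ring.
  by rewrite mr addr0 mulf_eq0 !subr_eq0.
by rewrite cards2; case: eqVneq.
Qed.

(** Sum [rootless_count] over the line and take the total number of roots from [card_conic]. *)
Lemma nrootless_count (eta : F) : eta != 0 -> eta != 1 ->
  ((nrootless eta).*2 + #|F|.+1 +
    #|[set s | #|[set x : F | x ^+ 2 - x + (1 - eta) * lform s == 0]%R| == 1%N]|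
   = #|F|.*2 + nsqrt ((1 - eta) * nform_disc)%R)%N.
Proof.
move=> eta0 eta1; rewrite -(card_conic eta0 eta1).
set n1 := #|[set s | _]|; set P := [set u | _].
suff <- : ((nrootless eta).*2 + #|P| + n1 = #|F|.*2)%N by lia.
have -> : #|F|.*2 = (\sum_(s : F) 2)%N by rewrite sum_nat_const muln2.
rewrite -(eq_bigr _ (fun s _ => rootless_count ((1 - eta) * lform s))).
rewrite !big_split /=; congr (_ + _ + _)%N.
- rewrite /nrootless -sum1_card big_mkcond /= -mul2n big_distrr /=.
  by apply: eq_bigr => s _; rewrite inE -mul2n; case: rootless.
- rewrite -sum1_card [LHS](partition_big (fun u : F * F => u.1) predT) //=.
  apply: eq_bigr => s _; rewrite sum1dep_card.
  have f_inj : injective (fun x : F => (s, x)) by move=> x x' [].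
  rewrite -[RHS](card_imset _ f_inj); apply: eq_card => -[a b]; rewrite !inE /=.
  apply/andP/imsetP => [[E /eqP as_] | [x]]; last by rewrite inE => E [-> ->].
  by exists b; rewrite ?inE -?as_.
- by rewrite /n1 -sum1_card big_mkcond /=; apply: eq_bigr => s _; rewrite inE; case: eqP.
Qed.

Lemma card_double_root (m : F) : 2%:R != 0 :> F ->
  (#|[set x : F | x ^+ 2 - x + m == 0]%R| == 1%N) = (1 == 4 * m).
Proof.
move=> two0; apply/cards1P/eqP => [[r Er] | E].
  have /eqP mr : r ^+ 2 - r + m == 0 by move/setP/(_ r): Er; rewrite !inE eqxx.
  have: 1 - r \in [set r].
    by rewrite -Er inE -mr; apply/eqP; ring.
  rewrite inE subr_eq => /eqP r2.
  apply/eqP; rewrite -subr_eq0; apply/eqP.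
  transitivity ((1 - 2 * r) ^+ 2 - 4 * (r ^+ 2 - r + m)); first by ring.
  by rewrite mr mulr_natl mulr2n -r2 subrr; ring.
exists (2^-1); apply/setP => x; rewrite !inE -[RHS]subr_eq0.
have four0 : 4%:R != 0 :> F by rewrite (natrM _ 2 2) mulf_neq0.
have -> : m = 4^-1.
  by apply: (mulfI four0); rewrite -E mulfV.
have -> : x ^+ 2 - x + 4^-1 = (x - 2^-1) ^+ 2.
  by field; rewrite two0.
by rewrite expf_eq0.
Qed.

Lemma nrootless_add_inv (eta : F) : eta != 0 -> eta != 1 ->
  (nrootless eta + nrootless eta^-1 = if odd #|F| then #|F| - 1 else #|F|)%N.
Proof.
move=> eta0 eta1.
have eta0' : eta^-1 != 0 by rewrite invr_eq0.
have eta1' : eta^-1 != 1 by rewrite invr_eq1.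
have := nrootless_count eta0 eta1; have := nrootless_count eta0' eta1'.
set n := #|_|; set n' := #|[set s | _]|.
have F0 : (0 < #|F|)%N by rewrite (ltn_trans _ (finNzRing_gt1 F)).
rewrite odd_card_finField; case: eqP => [two0 | /eqP two0] /=.
  (* In characteristic 2 a double root would satisfy [r = 1 - r], that is [1 = 0]. *)
  have zero : forall e : F,
      #|[set s | #|[set x : F | x ^+ 2 - x + (1 - e) * lform s == 0]%R| == 1%N]| = 0%N.
    move=> e; apply: eq_card0 => s; rewrite !inE; apply/cards1P => -[r Er].
    have /eqP mr : r ^+ 2 - r + (1 - e) * lform s == 0.
      by move/setP/(_ r): Er; rewrite !inE eqxx.
    have: 1 - r \in [set r].
      by rewrite -Er inE -mr; apply/eqP; ring.
    rewrite inE subr_eq -mulr2n -mulr_natl two0 mul0r.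
    by rewrite oner_eq0.
  have frob : injective (fun b : F => b ^+ 2).
    move=> x y /= E; apply/eqP; rewrite -subr_eq0 -[_ == 0](expf_eq0 _ 2).
    have -> : (x - y) ^+ 2 = x ^+ 2 - y ^+ 2 + 2%:R * (y ^+ 2 - x * y) by ring.
    by rewrite two0 mul0r addr0 E subrr.
  (* Squaring is injective, hence bijective, in characteristic 2. *)
  have one : forall k : F, k != 0 -> nsqrt k = 1%N.
    move=> k k0; apply/eqP/cards1P.
    have [g _ Kg] := injF_bij frob.
    exists (g k^-1); apply/setP => b; rewrite !inE -[RHS](inj_eq frob) [X in _ = (_ == X)]Kg.
    by rewrite -[RHS](inj_eq (mulfI k0)) mulfV.
  have disc0 : nform_disc != 0.
    rewrite /nform_disc (_ : 1 - 4 * d = 1 - 2%:R * (2%:R * d)); last by ring.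
    by rewrite two0 mul0r subr0 oner_eq0.
  rewrite /n /n' !zero !one ?mulf_neq0 // ?subr_eq0 1?eq_sym //.
  lia.
(* The double roots for [e] are the points of trace 0 for [e^-1]. *)
have step : forall e : F, e != 0 -> e != 1 ->
    #|[set s | #|[set x : F | x ^+ 2 - x + (1 - e) * lform s == 0]%R| == 1%N]|
      = nsqrt ((1 - e^-1) * nform_disc)%R.
  move=> e e0 e1.
  pose f (s : F) : F := 1 - 2 * s.
  have f_inj : injective f by move=> x y /addrI/oppr_inj/(mulfI two0).
  rewrite -(card_imset _ f_inj); apply: eq_card => r; rewrite inE.
  (* From [4 * lform s = 1 - nform_disc * f s ^+ 2], the discriminant is
     [e + (1 - e) * nform_disc * f s ^+ 2]; divide by [- e]. *)
  have fE s : (1 == 4 * ((1 - e) * lform s)) = ((1 - e^-1) * nform_disc * f s ^+ 2 == 1).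
    rewrite -subr_eq0 -[in RHS]subr_eq0 -[RHS](inj_eq (mulfI e0) _ 0) mulr0 -[RHS]oppr_eq0.
    by congr (_ == 0); rewrite /lform /nform_disc /f; field.
  apply/imsetP/idP => [[s] | E].
    by rewrite inE card_double_root // fE => E ->.
  have fK : r = f ((1 - r) / 2) by rewrite /f; field.
  by exists ((1 - r) / 2) => //; rewrite inE card_double_root // fE -fK.
rewrite /n /n' !step // invrK; move: F0.
move: #|F| (nsqrt _) (nsqrt _) (nrootless _) (nrootless _) => q a b a' b'; lia.
Qed.

End NormForm.

(** * Quadratic elements of an algebra *)

Section QuadraticElement.
Variables (F : fieldType) (A : algType F) (M : A) (t d : F).
Hypothesis M2 : M ^+ 2 = t *: M - d%:A.

Let mulM (a b : F) : (a%:A + b *: M) * M = (- (b * d))%:A + (a + b * t) *: M.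
Proof.
rewrite mulrDl mulr_algl -scalerAl -expr2 M2 scalerBr !scalerA scaleNr scalerDl.
by rewrite addrA [RHS]addrC.
Qed.

(** Interpolation at the roots: the remainder of [x^k] modulo [(x - mu)(x - nu)], multiplied by
    [nu - mu] to clear denominators. *)
Lemma quad_expr_split mu nu k : mu + nu = t -> mu * nu = d ->
  (nu - mu) *: M ^+ k
    = (nu * mu ^+ k - mu * nu ^+ k)%:A + (nu ^+ k - mu ^+ k) *: M.
Proof.
move=> tE dE; elim: k => [|k IH].
  by rewrite !expr0 !mulr1 subrr scale0r addr0.
rewrite exprSr scalerAl IH mulM; congr (_ *: _ + _ *: _); rewrite -?dE -?tE !exprS; ring.
Qed.

(** The remainder of [x^(k+1)] modulo [(x - mu)^2] is its tangent line at [mu]. *)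
Lemma quad_expr_double mu k : mu *+ 2 = t -> mu ^+ 2 = d ->
  M ^+ k.+1 = (- (k%:R * mu ^+ k.+1))%:A + (k.+1%:R * mu ^+ k) *: M.
Proof.
move=> tE dE; elim: k => [|k IH].
  by rewrite expr1 mul0r oppr0 scale0r add0r expr0 mulr1 scale1r.
rewrite exprSr IH mulM; congr (_ *: _ + _ *: _); rewrite -?dE -?tE !exprS.
  by rewrite -!natr1; ring.
by rewrite -!natr1; ring.
Qed.
End QuadraticElement.

(* If the roots of the quadratic are in F, then M^(q+1) = M^2 when they are
   distinct and M^(q+1) = mu M when they both equal mu. *)
Lemma quad_expS_card_scalar (F : finFieldType) (A : algType F) (M : A) (t d mu c : F) :
  M ^+ 2 = t *: M - d%:A -> mu ^+ 2 - t * mu + d = 0 ->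
  M ^+ (#|F| + 1) = c%:A -> exists e : F, M ^+ 2 = e%:A.
Proof.
move=> M2 mu_root Mq; pose nu := t - mu.
have tE : mu + nu = t by rewrite /nu; ring.
have dE : mu * nu = d.
  by apply/eqP; rewrite -subr_eq0 -oppr_eq0 -mu_root /nu; apply/eqP; ring.
have q1 (x : F) : x ^+ (#|F| + 1) = x ^+ 2 by rewrite addn1 exprS expf_card expr2.
have [E|nmu] := eqVneq nu mu.
  have tE2 : mu *+ 2 = t by rewrite mulr2n -[in X in _ + X]E.
  have dE2 : mu ^+ 2 = d by rewrite -dE E expr2.
  have := quad_expr_double M2 #|F| tE2 dE2.
  rewrite -addn1 Mq natrD finField_natf0 mul0r oppr0 scale0r !add0r mul1r expf_card.
  move=> muM; have [mu0|mu0] := eqVneq mu 0.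
    exists 0; rewrite M2 -tE2 -dE2 mu0 mul0rn expr0n.
    by rewrite scale0r sub0r scale0r oppr0.
  have -> : M = (c / mu)%:A.
    by rewrite mulrC -scalerA muM scalerA mulVf // scale1r.
  by exists ((c / mu) ^+ 2); rewrite expr2 mulr_algl scalerA -expr2.
exists c; rewrite -Mq; have nmu0 : nu - mu != 0 by rewrite subr_eq0.
have scK : injective (GRing.scale (nu - mu) : A -> A).
  by apply: can_inj (GRing.scale (nu - mu)^-1) _ => x; rewrite scalerA mulVf ?scale1r.
by apply: scK; rewrite !(quad_expr_split M2 _ tE dE) !q1.
Qed.

Section QuadraticSubalgebra.
Variables (F : finFieldType) (A : algType F) (X : A) (d : F).
Hypothesis X2 : X ^+ 2 = X - d%:A.
Hypothesis irr_d : forall x : F, x ^+ 2 - x + d != 0.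

(* The element of the field [F[X]] with coordinates [u]; its conjugate is
   [cx (u.1 + u.2, - u.2)] and its norm is [nform d u]. *)
Definition cx (u : F * F) : A := u.1%:A + u.2 *: X.

Lemma cxD u v : cx u + cx v = cx (u.1 + v.1, u.2 + v.2).
Proof. by rewrite /cx /= !scalerDl addrACA. Qed.

Lemma cxZ c u : c *: cx u = cx (c * u.1, c * u.2).
Proof. by rewrite /cx scalerDr !scalerA. Qed.

Lemma cx_scalar c : c%:A = cx (c, 0).
Proof. by rewrite /cx scale0r addr0. Qed.

Lemma cxM u v :
  cx u * cx v = cx (u.1 * v.1 - d * (u.2 * v.2), u.1 * v.2 + u.2 * v.1 + u.2 * v.2).
Proof.
have cxX : cx u * X = cx (- (d * u.2), u.1 + u.2).
  rewrite /cx mulrDl mulr_algl -scalerAl -expr2 X2 scalerBr scalerA scalerDl scaleNr.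
  by rewrite addrA [RHS]addrC mulrC.
rewrite [in LHS]/(cx v) mulrDr mulr_algr -scalerAr cxX !cxZ cxD.
by congr cx; congr pair; rewrite /=; ring.
Qed.

Definition conjx (u : F * F) : F * F := (u.1 + u.2, - u.2).

Lemma cx_norm u : cx u * cx (conjx u) = (nform d u)%:A.
Proof.
by rewrite cxM cx_scalar; congr cx; congr pair; rewrite /nform /=; ring.
Qed.

(** An element of the kernel has norm 0, and the norm form is anisotropic. *)
Lemma cx_inj : injective cx.
Proof.
have inj0 u : cx u = 0 -> u = 0.
  move=> u0; apply/eqP; rewrite -(nform_eq0 irr_d) -(inj_eq (fmorph_inj (in_alg A))).
  by rewrite rmorph0 /= -cx_norm u0 mul0r.
move=> u v E; apply/eqP; rewrite -subr_eq0; apply/eqP/inj0.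
have -> : cx (u - v) = cx u - cx v.
  by rewrite /cx /= !scalerBl opprD addrACA.
by rewrite E subrr.
Qed.

Lemma cx_unitP u : u != 0 -> exists2 v, cx v * cx u = 1 & cx u * cx v = 1.
Proof.
move=> u0; have n0 : nform d u != 0 by rewrite nform_eq0.
pose v := ((nform d u)^-1 * (conjx u).1, (nform d u)^-1 * (conjx u).2).
have uv : cx u * cx v = 1.
  by rewrite -cxZ -scalerAr cx_norm scalerA mulVf ?scale1r.
by exists v; rewrite // -uv !cxM; congr cx; congr pair; ring.
Qed.

Variable Y : A.
Hypothesis YX : Y * X = (1 - X) * Y.

Lemma cx_conj u : Y * cx u = cx (conjx u) * Y.
Proof.
rewrite /cx /= mulrDr mulrDl mulr_algr mulr_algl -scalerAr -scalerAl YX.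
by rewrite mulrBl mul1r scalerBr scalerDl scaleNr addrA.
Qed.

(** With [z = cx u], moving [Y] across [z] conjugates it, so [z (1 + Y) z = tr(z) z - n(z) (1 - Y)].
    Multiply on the left by [1 + Y] and use [(1 + Y)(1 - Y) = 1 - eta]. *)
Lemma sqr_onePY_mul_cx eta u : Y ^+ 2 = eta%:A ->
  ((1 + Y) * cx u) ^+ 2
    = (2 * u.1 + u.2) *: ((1 + Y) * cx u) - ((1 - eta) * nform d u)%:A.
Proof.
move=> Y2; set N := (1 + Y) * cx u.
have conjK : conjx (conjx u) = u by case: (u) => a b; rewrite /conjx /=; congr pair; ring.
have uY : cx u * Y = Y * cx (conjx u) by rewrite cx_conj conjK.
have uu : cx (conjx u) * cx u = (nform d u)%:A.
  by rewrite -cx_norm !cxM; congr cx; congr pair; ring.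
have u2 : cx u ^+ 2 = (2 * u.1 + u.2) *: cx u - (nform d u)%:A.
  rewrite expr2 cxM cxZ -scaleNr cx_scalar cxD.
  by congr cx; congr pair; rewrite /nform /=; ring.
have zY : cx u * (1 + Y) * cx u = (2 * u.1 + u.2) *: cx u - nform d u *: (1 - Y).
  rewrite (mulrDr _ 1) mulr1 uY (mulrDl (cx u)) -expr2 u2 -mulrA uu mulr_algr scalerBr opprB.
  by rewrite -addrA; congr (_ + _); rewrite addrC.
rewrite expr2 /N mulrA -[X in X * _]mulrA -mulrA zY mulrBr -!scalerAr; congr (_ - _).
rewrite (mulrC (1 - eta)) -scalerA; congr (_ *: _).
by rewrite mulrDl !mulrBr !mulr1 !mul1r -expr2 Y2 scalerBl scale1r addrA subrK.
Qed.
End QuadraticSubalgebra.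

(** * Lifts to GL(2,q) and the nonsplit torus *)

Section TwoByTwo.
Variable R : comNzRingType.
Implicit Types M N : 'M[R]_2.

Lemma mx2P M N : M 0 0 = N 0 0 -> M 0 1 = N 0 1 -> M 1 0 = N 1 0 -> M 1 1 = N 1 1 ->
  M = N.
Proof.
have ord2 (i : 'I_2) : i = 0 \/ i = 1.
  by case: i => -[|[|//]] i2; [left | right]; apply/val_inj.
move=> E00 E01 E10 E11; apply/matrixP => i j.
by have [->|->] := ord2 i; have [->|->] := ord2 j.
Qed.

Lemma mx2_mulE M N i j : (M * N) i j = M i 0 * N 0 j + M i 1 * N 1 j.
Proof.
rewrite mxE big_ord_recl big_ord1; congr (_ + M i _ * N _ j); exact/val_inj.
Qed.

(** Cayley-Hamilton, with [t] the trace and [d] the determinant. *)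
Lemma mx2_quad M : exists t d, M ^+ 2 = t *: M - d%:A.
Proof.
exists (M 0 0 + M 1 1), (M 0 0 * M 1 1 - M 0 1 * M 1 0); rewrite expr2.
by apply: mx2P; rewrite mx2_mulE !mxE /=; ring.
Qed.
End TwoByTwo.

Lemma mx2_comm_cx (F : finFieldType) (X N : 'M[F]_2) d :
  X ^+ 2 = X - d%:A -> (forall x : F, x ^+ 2 - x + d != 0) ->
  N * X = X * N -> exists u, N = cx X u.
Proof.
move=> X2 irr_d NX.
have E00 : X 0 0 * X 0 0 + X 0 1 * X 1 0 = X 0 0 - d.
  by rewrite -mx2_mulE -expr2 X2 !mxE /= mulr1.
(* Otherwise [X] is triangular and [X 0 0] is a root of [x^2 - x + d]. The coefficient of [X] in [N]
   can then be read off this entry. *)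
have X10 : X 1 0 != 0.
  apply: contraNneq (irr_d (X 0 0)) => X10; apply/eqP.
  by move: E00; rewrite X10 mulr0 addr0 expr2 => ->; ring.
have C00 : N 0 0 * X 0 0 + N 0 1 * X 1 0 = X 0 0 * N 0 0 + X 0 1 * N 1 0.
  by rewrite -!mx2_mulE NX.
have C10 : N 1 0 * X 0 0 + N 1 1 * X 1 0 = X 1 0 * N 0 0 + X 1 1 * N 1 0.
  by rewrite -!mx2_mulE NX.
exists (N 0 0 - N 1 0 / X 1 0 * X 0 0, N 1 0 / X 1 0); apply: mx2P; rewrite !mxE /=.
- by rewrite mulr1 subrK.
- apply: (mulIf X10); rewrite mulr0 add0r.
  transitivity (X 0 1 * N 1 0); last by field.
  by apply: (addrI (N 0 0 * X 0 0)); rewrite C00 [X 0 0 * _]mulrC.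
- by rewrite mulr0 add0r divfK.
apply: (mulIf X10); rewrite mulr1.
transitivity (X 1 0 * N 0 0 + X 1 1 * N 1 0 - N 1 0 * X 0 0); last by field.
by rewrite -C10; ring.
Qed.

Section ProjectiveClasses.
Variable F : finFieldType.
Local Notation GL2 := {'GL_2[F]}.
Local Notation Z := (GLscalar 2 F).
Implicit Types u v w : GL2.

(* [GLval u] has type ['M_2.-1.+1], on which ring notations are not inferred as
   on ['M_2]. *)
Definition gmx u : 'M[F]_2 := GLval u.

Definition pcl u : coset_of Z := coset Z u.

Lemma gmx_inj : injective gmx. Proof. exact: val_inj. Qed.

Lemma gmx1 : gmx 1%g = 1. Proof. by []. Qed.

Lemma gmxM u v : gmx (u * v)%g = gmx u * gmx v. Proof. by []. Qed.

Lemma gmxX u n : gmx (u ^+ n)%g = gmx u ^+ n.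
Proof. by elim: n => // n IH; rewrite expgS gmxM IH exprS. Qed.

Lemma gmxV u : gmx u^-1%g * gmx u = 1.
Proof. by rewrite -gmxM mulVg. Qed.

Lemma gmx_lreg u (M N : 'M[F]_2) : gmx u * M = gmx u * N -> M = N.
Proof. by move=> E; rewrite -[M]mul1r -(gmxV u) -mulrA E mulrA gmxV mul1r. Qed.

Lemma gmxVr u : gmx u * gmx u^-1%g = 1.
Proof. by rewrite -gmxM mulgV. Qed.

Lemma gmx_rreg u (M N : 'M[F]_2) : M * gmx u = N * gmx u -> M = N.
Proof. by move=> E; rewrite -[M]mulr1 -(gmxVr u) mulrA E -mulrA gmxVr mulr1. Qed.

Lemma gmx_neq0 u : gmx u != 0.
Proof.
by apply: contraTneq (oner_neq0 'M[F]_2) => u0; rewrite -(gmxV u) u0 mulr0 eqxx.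
Qed.

Lemma gmx_lift (M N : 'M[F]_2) : N * M = 1 -> exists u, gmx u = M.
Proof.
move=> NM; have uM : M \in unitmx by case/mulmx1_unit: NM.
by exists (FinRing.unit 'M[F]_2 uM).
Qed.

Lemma mem_GLscalar u : (u \in Z) <-> exists c : F, gmx u = c%:A.
Proof.
by rewrite inE; split=> [/is_scalar_mxP[c E] | [c E]];
  [exists c; rewrite scalemx1 | apply/is_scalar_mxP; exists c; rewrite -scalemx1].
Qed.

Lemma GL_normZ u : u \in 'N(Z)%g.
Proof. by apply: (subsetP (normal_norm (GLscalar_normal 2 F))); rewrite inE. Qed.
Hint Resolve GL_normZ : core.

Lemma pclM u v : pcl (u * v)%g = (pcl u * pcl v)%g.
Proof. by rewrite /pcl morphM. Qed.

Lemma pclX u n : pcl (u ^+ n)%g = (pcl u ^+ n)%g.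
Proof. by rewrite /pcl morphX. Qed.

Lemma pclV u : pcl u^-1%g = (pcl u)^-1%g.
Proof. by rewrite /pcl morphV. Qed.

Lemma pcl_PGL u : pcl u \in PGL 2 F.
Proof. by apply: mem_quotient; rewrite inE. Qed.

Lemma pcl_lift g : exists u, g = pcl u.
Proof. by case: (cosetP g) => u _ ->; exists u. Qed.

Lemma pcl_eq1 u : pcl u = 1%g <-> exists c : F, gmx u = c%:A.
Proof.
rewrite -mem_GLscalar; split; last exact: coset_id.
exact: coset_idr.
Qed.

Lemma pcl_eq u v : pcl u = pcl v <-> exists c : F, gmx u = c *: gmx v.
Proof.
have -> : pcl u = pcl v <-> pcl (u * v^-1)%g = 1%g.
  by rewrite pclM pclV; split=> [-> | /eqP]; rewrite ?mulgV // -eq_mulgV1 => /eqP.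
rewrite pcl_eq1 gmxM; split=> -[c E]; exists c.
  by rewrite -[gmx u]mulr1 -(gmxV v) mulrA E mulr_algl.
by rewrite E -scalerAl -gmxM mulgV gmx1.
Qed.

Lemma card_GLscalar : #|Z| = #|F|.-1.
Proof.
rewrite -(card_imset _ gmx_inj) -(cardsC1 (0 : F)).
have sc_inj : injective (fun c : F => c%:A : 'M[F]_2) by exact: (fmorph_inj (in_alg _)).
rewrite -(card_imset _ sc_inj); congr #|pred_of_set _|.
apply/setP => M; apply/imsetP/imsetP => [[u uZ ->] | [c c0 ->]].
  have [c E] := (mem_GLscalar u).1 uZ; exists c => //; rewrite !inE.
  by apply: contraNneq (gmx_neq0 u) => c0; rewrite E c0 scale0r.
rewrite !inE in c0; have [|u E] := @gmx_lift c%:A (c^-1)%:A.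
  by rewrite mulr_algl scalerA mulVf ?scale1r.
by exists u => //; apply/mem_GLscalar; exists c.
Qed.

Section Torus.
Variables (x0 : GL2) (d : F).
Hypothesis X2 : gmx x0 ^+ 2 = gmx x0 - d%:A.
Hypothesis irr_d : forall x : F, x ^+ 2 - x + d != 0.

Lemma cent_cx v : v \in 'C[x0]%g <-> exists2 z, z != 0 & gmx v = cx (gmx x0) z.
Proof.
split=> [/cent1P vx | [z _ vz]].
  have [|z vz] := mx2_comm_cx (N := gmx v) X2 irr_d; first by rewrite -!gmxM vx.
  exists z => //; apply: contraNneq (gmx_neq0 v) => z0; rewrite vz z0.
  by rewrite /cx !scale0r addr0.
apply/cent1P/gmx_inj; rewrite !gmxM vz.
have -> : gmx x0 = cx (gmx x0) (0, 1) by rewrite /cx scale0r scale1r add0r.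
by rewrite /cx scale0r scale1r add0r mulrDl mulrDr mulr_algl mulr_algr -scalerAl -scalerAr.
Qed.

Lemma cx_lift z : z != 0 -> exists2 v, v \in 'C[x0]%g & gmx v = cx (gmx x0) z.
Proof.
move=> z0; have [y yz _] := cx_unitP X2 irr_d z0.
by have [v vz] := gmx_lift yz; exists v => //; apply/cent_cx; exists z.
Qed.

(** The centraliser is the multiplicative group of the field [F[X]], of order [q^2 - 1], and there
    are [q - 1] scalars. *)
Lemma card_cent_PGL : #|'C[x0] / Z|%g = #|F|.+1.
Proof.
have q1 := finNzRing_gt1 F.
have sZC : Z \subset 'C[x0]%g.
  apply/subsetP => u /mem_GLscalar[c E]; apply/cent1P/gmx_inj.
  by rewrite !gmxM E mulr_algl mulr_algr.
have cC : #|'C[x0]%g| = (#|F| * #|F|).-1.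
  rewrite -(card_imset _ gmx_inj) -card_prod -(cardsC1 (0 : F * F)).
  rewrite -(card_imset _ (cx_inj X2 irr_d)); congr #|pred_of_set _|.
  apply/setP => M; apply/imsetP/imsetP => [[u /cent_cx[z z0 E] ->] | [z z0 ->]].
    by exists z => //; rewrite !inE.
  by rewrite !inE in z0; have [v vC E] := cx_lift z0; exists v.
rewrite card_quotient; last by apply/subsetP.
rewrite -divgS // cC card_GLscalar.
case: #|F| q1 => [|[|n]] // _; rewrite /= -[RHS](mulKn _ (ltn0Sn n)); congr (_ %/ _)%N.
by lia.
Qed.
End Torus.

(** * Membership in [A] read off a lift, and its count on a coset of the torus *)

Definition nonsplit : {set coset_of Z} :=
  [set g in PGL 2 F | (g ^+ (#|F| + 1) == 1)%g && (g ^+ 2 != 1)%g].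

(** Scaling the lift by [t^-1] keeps its class and brings its trace to 1. *)
Lemma quad_normalize u t d : t != 0 -> gmx u ^+ 2 = t *: gmx u - d%:A ->
    (forall x : F, x ^+ 2 - t * x + d != 0) ->
  exists v d', [/\ pcl v = pcl u, gmx v ^+ 2 = gmx v - d'%:A
                 & forall x : F, x ^+ 2 - x + d' != 0].
Proof.
move=> t0 u2 irr.
have [v vu] : exists v, gmx v = t^-1 *: gmx u.
  apply: (@gmx_lift _ (t *: gmx u^-1%g)).
  by rewrite -scalerAl -scalerAr scalerA mulfV // scale1r gmxV.
exists v, (d / t ^+ 2); split; first by apply/pcl_eq; exists t^-1.
  rewrite vu exprZn u2 scalerBr !scalerA; congr (_ *: _ - _ *: _).
    by field.
  by field.
move=> x.
have -> : x ^+ 2 - x + d / t ^+ 2 = ((t * x) ^+ 2 - t * (t * x) + d) / t ^+ 2 by field.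
by rewrite mulf_neq0 // invr_eq0 expf_neq0.
Qed.

(** If [t = 0] or the quadratic has a root, membership would force [u^2] to be scalar. Conversely,
    the class lies in the image of the centraliser of a normalised lift, a group of order [q + 1],
    and [u^2] scalar with [t] nonzero would make [u] scalar. *)
Lemma mem_nonsplit u t d : gmx u ^+ 2 = t *: gmx u - d%:A -> pcl u <> 1%g ->
  pcl u \in nonsplit <-> t != 0 /\ forall x : F, x ^+ 2 - t * x + d != 0.
Proof.
move=> u2 u1; rewrite inE pcl_PGL -!pclX /=; split.
  case/andP=> /eqP/pcl_eq1[c]; rewrite gmxX => uq /eqP u2n1.
  have n2 : ~ exists e : F, gmx u ^+ 2 = e%:A by rewrite -gmxX -pcl_eq1.
  split; first by apply/eqP => t0; case: n2; exists (- d); rewrite u2 t0 scale0r sub0r scaleNr.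
  move=> x; apply/eqP => x_root; case: n2.
  exact: (quad_expS_card_scalar u2 x_root uq).
case=> t0 irr; apply/andP; split; last first.
  apply/eqP => /pcl_eq1[e]; rewrite gmxX u2 => /(canRL (subrK _)).
  rewrite -scalerDl => E; case: u1; apply/pcl_eq1; exists (t^-1 * (e + d)).
  by rewrite -scalerA -E scalerA mulVf // scale1r.
have [v [d' [vu v2 irr']]] := quad_normalize t0 u2 irr.
rewrite pclX -vu addn1 -(card_cent_PGL v2 irr').
by rewrite expg_cardG //; apply: mem_quotient; apply: cent1id.
Qed.

(** A torus element contributing to the count has a lift [z] of nonzero trace, so exactly one
    multiple of [z] lies on the line of trace 1. *)
Lemma card_torus_coset x0 d w Y eta :
  gmx x0 ^+ 2 = gmx x0 - d%:A -> (forall x : F, x ^+ 2 - x + d != 0) ->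
  Y * gmx x0 = (1 - gmx x0) * Y -> Y ^+ 2 = eta%:A -> eta != 0 -> gmx w = 1 + Y ->
  #|[set t in ('C[x0] / Z)%g | (pcl w * t)%g \in nonsplit]| = nrootless d eta.
Proof.
move=> X2 irr_d YX Y2 eta0 wY.
pose line (s : F) : F * F := (s, 1 - 2 * s).
have line_tr s : 2 * (line s).1 + (line s).2 = 1 by rewrite /=; ring.
have line0 s : line s != 0.
  by apply: contra_eq_neq (line_tr s) => ->; rewrite /= mulr0 addr0 eq_sym oner_neq0.
(* If [(1 + Y) z] were scalar, [Y] would lie in [F[X]] and commute with [X]. Then [(1 - 2 X) Y = 0]
   with [1 - 2 X] invertible, so [Y = 0], against [eta0]. *)
have nlist v z : gmx v = cx (gmx x0) z -> pcl (w * v)%g <> 1%g.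
  move=> vz /pcl_eq1[c]; rewrite gmxM wY vz => E.
  have z0 : z != 0.
    by apply: contraNneq (gmx_neq0 v) => z0; rewrite vz z0 /cx !scale0r addr0.
  have [y _ zy] := cx_unitP X2 irr_d z0.
  have Y_cx : Y = c *: cx (gmx x0) y - 1.
    by rewrite -mulr_algl -E -mulrA zy mulr1 addrC addKr.
  have YXC : Y * gmx x0 = gmx x0 * Y.
    rewrite Y_cx mulrBl mulrBr mul1r mulr1 -scalerAl -scalerAr; congr (_ *: _ - _).
    by rewrite /cx mulrDl mulrDr mulr_algl mulr_algr -scalerAl -scalerAr.
  have dY : cx (gmx x0) (1, -2%:R) * Y = 0.
    have -> : cx (gmx x0) (1, -2%:R) = 1 - gmx x0 - gmx x0.
      by rewrite /cx /= scale1r scaleNr scaler_nat mulr2n opprD addrA.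
    by rewrite mulrBl -YX YXC subrr.
  have [|y' y'd _] := @cx_unitP _ _ _ _ X2 irr_d (1, -2%:R).
    by rewrite xpair_eqE oner_eq0.
  have Y0 : Y = 0 by rewrite -[Y]mul1r -y'd -mulrA dY mulr0.
  case/eqP: eta0; apply: (fmorph_inj (in_alg 'M[F]_2)).
  by rewrite rmorph0 /= -Y2 Y0 expr0n.
have mem_nsplit v z : gmx v = cx (gmx x0) z ->
    (pcl w * pcl v)%g \in nonsplit <-> 2 * z.1 + z.2 != 0 /\
      forall x : F, x ^+ 2 - (2 * z.1 + z.2) * x + (1 - eta) * nform d z != 0.
  move=> vz; rewrite -pclM; apply: mem_nonsplit; last exact: nlist vz.
  by rewrite gmxM wY vz (sqr_onePY_mul_cx X2 YX _ Y2).
have line_norm s : nform d (line s) = lform d s by rewrite /nform /lform /=; ring.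
(* The default [x0] is never reached: [cx_lift] provides a lift of every nonzero point. *)
pose f s := odflt x0 [pick v | gmx v == cx (gmx x0) (line s)].
have fE s : gmx (f s) = cx (gmx x0) (line s).
  rewrite /f; case: pickP => [v /eqP // | no].
  by have [v _ /eqP] := cx_lift X2 irr_d (line0 s); rewrite no.
have pf_inj : injective (fun s => pcl (f s)).
  move=> s s' /pcl_eq[c]; rewrite !fE cxZ => /(cx_inj X2 irr_d)[/= E1 E2].
  have c1 : c = 1.
    transitivity (2 * (c * s') + c * (1 - 2 * s')); first by ring.
    by rewrite -E1 -E2; ring.
  by rewrite E1 c1 mul1r.
rewrite /nrootless -(card_imset _ pf_inj); apply: eq_card => t; rewrite inE.
apply/andP/imsetP => [[/morphimP[v _ vC ->]] | [s]].
  have [z z0 vz] := (cent_cx X2 irr_d v).1 vC.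
  move=> gt; have [tr0 irr] := (mem_nsplit v z vz).1 gt; set tr := 2 * z.1 + z.2 in tr0 irr.
  have lz : line (z.1 / tr) = (tr^-1 * z.1, tr^-1 * z.2).
    by congr pair; [rewrite mulrC | rewrite /tr; field].
  exists (z.1 / tr); last first.
    by apply/pcl_eq; exists tr; rewrite fE lz vz cxZ /= !mulrA !mulfV // !mul1r; case: (z).
  rewrite inE; apply/forallP => x; rewrite -line_norm lz.
  have := irr (tr * x); apply: contraNneq => E.
  have -> : (tr * x) ^+ 2 - tr * (tr * x) + (1 - eta) * nform d z
     = tr ^+ 2 * (x ^+ 2 - x + (1 - eta) * nform d (tr^-1 * z.1, tr^-1 * z.2)).
    by rewrite /nform /=; field.
  by rewrite E mulr0.
rewrite inE => /forallP irr ->; split.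
  by apply: mem_quotient; apply/(cent_cx X2 irr_d); exists (line s); rewrite ?fE.
apply: (mem_nsplit _ _ (fE s)).2; rewrite line_tr oner_eq0; split=> // x.
by rewrite mul1r line_norm.
Qed.

End ProjectiveClasses.

(** * Dihedral groups *)

Section DihedralCounting.
Local Open Scope group_scope.
Variable gT : finGroupType.
Implicit Types (A : {set gT}) (D : {group gT}) (x y g : gT).

(** Put [b = h^-1], so that [a = g h]; the count becomes that of the coset [g D] inside [A]. *)
Lemma card_factorisations A D g :
  #|[set ab in setX A D | ab.1 * ab.2 == g]| = #|[set h in D | g * h \in A]|.
Proof.
pose f h := (g * h, h^-1).
have f_inj : injective f by move=> h h' [_ /invg_inj].
rewrite -(card_imset _ f_inj); apply: eq_card => -[a b]; rewrite !inE /=.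
apply/andP/imsetP => [[/andP[aA bD] /eqP abg] | [h]].
  exists b^-1; first by rewrite inE groupV bD -abg mulgK.
  by rewrite /f -abg mulgK invgK.
by rewrite inE => /andP[hD ghA] [-> ->]; rewrite groupV ghA hD mulgK eqxx.
Qed.

Lemma card_translate D (P : pred gT) x : x \in D ->
  #|[set h in D | P (x * h)]| = #|[set h in D | P h]|.
Proof.
move=> xD; rewrite -(card_imset _ (mulgI x)); apply: eq_card => h; rewrite inE.
apply/imsetP/andP => [[k] | [hD Ph]].
  by rewrite inE => /andP[kD Pk] ->; rewrite groupM.
by exists (x^-1 * h); rewrite ?inE mulKVg // groupM ?groupV.
Qed.

Lemma card_index2 D (H : {group gT}) (P : pred gT) y :
  H \subset D -> #|D| = (2 * #|H|)%N -> y \in D -> y \notin H ->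
  #|[set h in D | P h]| = (#|[set h in H | P h]| + #|[set h in H | P (y * h)%g]|)%N.
Proof.
move=> sHD oD yD yH.
have disj : H :&: y *: H = set0.
  apply/setP => h; rewrite !inE mem_lcoset; apply/negP => /andP[hH yh].
  by rewrite -groupV -(groupMr _ hH) yh in yH.
have defD : D = H :|: y *: H :> {set gT}.
  apply/esym/eqP; rewrite eqEcard subUset sHD mul_subG ?sub1set //=.
  by rewrite cardsU disj cards0 subn0 card_lcoset oD mul2n addnn.
rewrite -(cardsID H) defD; congr (_ + _)%N.
  by apply: eq_card => h; rewrite !inE; case: (h \in H); rewrite ?andbF ?andbT.
rewrite -[RHS](card_imset _ (mulgI y)); apply: eq_card => h; rewrite !inE mem_lcoset.
have nH k : k \in H -> y * k \notin H by move=> kH; rewrite groupMr.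
apply/andP/imsetP => [[hH /andP[]] | [k]].
  by rewrite (negbTE hH) /= => yh Ph; exists (y^-1 * h); rewrite ?inE ?yh mulKVg.
by rewrite inE => /andP[kH Pk] ->; rewrite nH // mulKg kH orbT.
Qed.

Lemma dihedral_generators D (n : nat) : (1 < n)%N -> D \isog 'D_(2 * n) ->
  exists x y, [/\ #[x] = n, <[x]> \subset D, #|D| = (2 * n)%N,
                  y \in D :\: <[x]> & y ^+ 2 = 1 /\ x ^ y = x^-1].
Proof.
rewrite mul2n => n1 /(isoGrpP _ (Grp_dihedral n1))[]; rewrite card_dihedral // => oD.
case/existsP => -[x y] /= /eqP[defD xn y2 xy].
have nxy : <[y]> \subset 'N(<[x]>) by rewrite cycle_subG inE -cycleJ xy cycleV.
have ox : (#[x] <= n)%N by rewrite dvdn_leq ?order_dvdn ?xn // ltnW.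
have oy : (#[y] <= 2)%N by rewrite dvdn_leq ?order_dvdn ?y2.
(* The relations only bound the orders by [n] and 2; that [x] has order exactly [n] follows from
   [#|D| = 2 n]. *)
have := mul_cardG <[x]> <[y]>; rewrite -norm_joinEr // defD oD -!orderE => oxy.
have I0 : (0 < #|<[x]> :&: <[y]>|)%N := cardG_gt0 _.
have [xD yD] : <[x]> \subset D /\ <[y]> \subset D by rewrite -defD joing_subl joing_subr.
have oxn : #[x] = n.
  apply/eqP; rewrite eqn_leq ox /= -(leq_pmul2r (ltn0Sn 1)).
  rewrite (leq_trans _ (leq_mul (leqnn #[x]) oy)) // oxy muln2.
  by rewrite -[X in (X <= _)%N]muln1 leq_mul.
exists x, y; split=> //.
rewrite inE -!cycle_subG yD andbT; apply/negP => sxy.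
have: (#|D| <= n)%N by rewrite -defD (joing_idPl _) // -orderE oxn.
by rewrite oD; lia.
Qed.

(** For even order the solutions form the subgroup generated by the half power of [x]. *)
Lemma card_cycle_sqr1 x : #|[set t in <[x]> | t ^+ 2 == 1]| = (~~ odd #[x]).+1.
Proof.
have [ox|ex] /= := boolP (odd #[x]).
  apply/eqP/cards1P; exists 1; apply/setP => t; rewrite !inE.
  apply/andP/eqP => [[/order_dvdG ot t2] | ->]; last by rewrite group1 expg1n.
  apply/eqP; rewrite -order_eq1 -dvdn1 -(eqP (_ : coprime #[x] 2)) ?coprimen2 //.
  by rewrite dvdn_gcd ot order_dvdn t2.
have o2 : #[x] = ((#[x])./2 * 2)%N by rewrite muln2 even_halfK.
have k0 : (0 < (#[x])./2)%N by move: (order_gt0 x); rewrite {1}o2 muln_gt0 => /andP[].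
have kx : ((#[x])./2 %| #[x])%N by rewrite {2}o2 dvdn_mulr.
transitivity #[x ^+ (#[x])./2]; last by rewrite orderXdiv // {1}o2 mulKn.
rewrite orderE; apply: eq_card => t; rewrite !inE; apply/andP/idP => [[/cycleP[i ->]] | ].
  rewrite -expgM -order_dvdn {1}o2 dvdn_pmul2r // => /dvdnP[j ->].
  by rewrite mulnC expgM mem_cycle.
case/cycleP => j ->; rewrite -expgM mem_cycle -expgM mulnAC -o2 expgM expg_order.
by rewrite expg1n.
Qed.

End DihedralCounting.

(** * Cosets of the dihedral group *)

Section TorusNormaliser.
Variables (F : finFieldType) (x0 y0 : {'GL_2[F]}) (d : F).
Local Notation X := (gmx x0).
Local Notation Y0 := (gmx y0).
Hypothesis X2 : X ^+ 2 = X - d%:A.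
Hypothesis irr_d : forall x : F, x ^+ 2 - x + d != 0.

Lemma comm_one_sub (N : 'M[F]_2) : N * X = X * N -> N * (1 - X) = (1 - X) * N.
Proof. by move=> NX; rewrite mulrBr mulrBl mulr1 mul1r NX. Qed.

(** As [X (1 - X) = d], the inverse of [X] is its Galois conjugate up to a scalar. Conjugation
    preserves the quadratic equation of [X], which fixes the scalar. *)
Lemma conj_inverse_swaps :
  (pcl x0 ^ pcl y0)%g = (pcl x0)^-1%g -> Y0 * X = (1 - X) * Y0.
Proof.
move=> xy.
have d0 : d != 0 by have := irr_d 0; rewrite expr0n subr0 add0r.
have [c conjX] : exists c : F, gmx (x0 ^ y0)%g = c *: gmx x0^-1%g.
  by apply/pcl_eq; rewrite pclV -xy /conjg !pclM pclV.
have XV : gmx x0^-1%g = d^-1 *: (1 - X).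
  apply: (@gmx_lreg _ x0); rewrite gmxVr -scalerAr mulrBr mulr1 -expr2 X2 opprB addrC subrK.
  by rewrite scalerA mulVf ?scale1r.
pose e := c / d.
have WE : gmx (x0 ^ y0)%g = cx X (e, - e).
  by rewrite conjX XV scalerA /cx /= scaleNr scalerBr.
(* W = e (1 - X) satisfies the same quadratic equation as X, whence e^2 = e. *)
have W2 : gmx (x0 ^ y0)%g ^+ 2 = gmx (x0 ^ y0)%g - d%:A.
  rewrite expr2 /conjg !gmxM !mulrA -(mulrA _ Y0) gmxVr mulr1 -(mulrA _ X X) -expr2 X2.
  by rewrite mulrBr mulrBl mulr_algr -scalerAl gmxV.
have e1 : e = 1.
  have e0 : e != 0.
    by apply: contraNneq (gmx_neq0 (x0 ^ y0)%g) => e0; rewrite WE e0 oppr0 /cx !scale0r addr0.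
  move: W2; rewrite WE expr2 (cxM X2) (cx_scalar X) -scaleN1r cxZ cxD.
  case/(cx_inj X2 irr_d) => _ /= ee; apply: (mulfI e0); apply: oppr_inj.
  transitivity (e * - e + - e * e + - e * - e); first by ring.
  by rewrite ee; ring.
have YXW : X * Y0 = Y0 * gmx (x0 ^ y0)%g by rewrite -!gmxM conjgC.
rewrite mulrBl mul1r YXW WE e1 /cx /= scale1r scaleN1r mulrBr mulr1 opprB addrC subrK //.
Qed.

Hypothesis Y0X : Y0 * X = (1 - X) * Y0.

Lemma swap_conj : gmx y0^-1%g * X = (1 - X) * gmx y0^-1%g.
Proof.
apply: (@gmx_lreg _ y0); apply: (@gmx_rreg _ y0).
rewrite !mulrA gmxVr mul1r -!mulrA gmxV mulr1 mulrBr mulr1 Y0X.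
by rewrite mulrBl mul1r opprB addrC subrK.
Qed.

(* Both N1 = M X - (1 - X) M and N2 = (M X - X M) / Y0 commute with X, and
   (1 - 2 X) M = N2 Y0 - N1. *)
Lemma cx_decomposition (M : 'M[F]_2) : exists a b, M = cx X a + cx X b * Y0.
Proof.
pose N1 := M * X - (1 - X) * M; pose N2 := (M * X - X * M) * gmx y0^-1%g.
have XX : X * X = X - d%:A by rewrite -expr2.
have N1X : N1 * X = X * N1.
  rewrite /N1 [LHS]mulrBl -(mulrA M X X) XX mulrBr mulr_algr (mulrBl M 1) mul1r (mulrBl X M).
  by rewrite [RHS]mulrBr (mulrBr X M) !mulrA XX mulrBl mulr_algl subKr opprB addrC addrA subrK.
have N2X : N2 * X = X * N2.
  rewrite /N2 -mulrA swap_conj !mulrA; congr (_ * _).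
  rewrite mulrBr mulr1 (mulrBl X (M * X)) -(mulrA M X X) XX mulrBr mulr_algr.
  rewrite [RHS]mulrBr !mulrA XX.
  by rewrite mulrBl mulr_algl !opprB addrC -addrA [_ - _ + _]addrA subrK.
have [u1 E1] := mx2_comm_cx X2 irr_d N1X.
have [u2 E2] := mx2_comm_cx X2 irr_d N2X.
(* [1 - 2 X] is a nonzero element of the field [F[X]], also in characteristic 2, where it is 1. *)
have [|y' y'd _] := @cx_unitP _ _ _ _ X2 irr_d (1, -2%:R).
  by rewrite xpair_eqE oner_eq0.
have dM : cx X (1, -2%:R) * M = N2 * Y0 - N1.
  have -> : cx X (1, -2%:R) = 1 - X - X.
    by rewrite /cx /= scale1r scaleNr scaler_nat mulr2n opprD addrA.
  rewrite /N2 -mulrA gmxV mulr1 /N1 opprB [RHS]addrC addrA subrK.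
  by rewrite [LHS]mulrBl.
have [a aE] : exists a, - (cx X y' * cx X u1) = cx X a.
  by rewrite (cxM X2) -scaleN1r cxZ; eexists.
have [b bE] : exists b, cx X y' * cx X u2 = cx X b by rewrite (cxM X2); eexists.
by exists a, b; rewrite -[LHS]mul1r -y'd -mulrA dM mulrBr E1 E2 addrC aE mulrA bE.
Qed.

(** The square commutes with [X], so it lies in [F[X]]; it also commutes with [v], which acts there
    as Galois conjugation, so it lies in [F]. *)
Lemma swap_sqr_scalar (v : {'GL_2[F]}) :
  gmx v * X = (1 - X) * gmx v -> exists2 eta : F, eta != 0 & gmx v ^+ 2 = eta%:A.
Proof.
set Y := gmx v => YX.
have Y2X : Y ^+ 2 * X = X * Y ^+ 2.
  by rewrite expr2 -mulrA YX (mulrA Y) mulrBr mulr1 YX (mulrBl Y 1) mul1r subKr mulrA.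
have [u Eu] := mx2_comm_cx X2 irr_d Y2X.
have /(cx_inj X2 irr_d) : cx X (conjx u) = cx X u.
  apply: (@gmx_rreg _ v); rewrite -/Y -(cx_conj YX) -Eu.
  by rewrite -exprS -exprSr.
move/(congr1 fst) => /= u21; have u2 : u.2 = 0 by rewrite -[LHS](addKr u.1) u21 addNr.
have vv : gmx v ^+ 2 = u.1%:A by rewrite Eu /cx u2 scale0r addr0.
exists u.1 => //; apply: contraNneq (gmx_neq0 (v ^+ 2)%g) => u1.
by rewrite gmxX vv u1 scale0r.
Qed.

Local Notation Z := (GLscalar 2 F).

Lemma card_nonsplit_coset (D : {group coset_of Z}) g :
  ('C[x0] / Z \subset D)%g -> #|D| = (2 * #|'C[x0] / Z|%g)%N ->
  pcl y0 \in D -> g \notin D ->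
  #|[set h in D | (g * h)%g \in nonsplit F]|
    = (if odd #|F| then #|F| - 1 else #|F|)%N.
Proof.
move=> sTD oD yD; have [m ->] := pcl_lift g; move=> gD.
have inT v z : z != 0 -> gmx v = cx X z -> pcl v \in ('C[x0] / Z)%g.
  by move=> z0 vz; apply: mem_quotient; apply/(cent_cx X2 irr_d); exists z.
have [a [b mE]] := cx_decomposition (gmx m).
have cx0 : cx X 0 = 0 by rewrite /cx !scale0r addr0.
have b0 : b != 0.
  apply: contraNneq gD => b0; rewrite b0 cx0 mul0r addr0 in mE.
  apply: (subsetP sTD); apply: (inT m a) => //; apply: contraNneq (gmx_neq0 m) => a0.
  by rewrite mE a0 cx0.
have [vb vbC vbE] := cx_lift X2 irr_d b0.
have a0 : a != 0.
  apply: contraNneq gD => a0; rewrite a0 cx0 add0r -vbE -gmxM in mE.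
  by rewrite (gmx_inj mE) pclM groupM // (subsetP sTD) // (inT _ b).
have [va vaC vaE] := cx_lift X2 irr_d a0.
(* Dividing [a + b Y0] on the right by [a], which belongs to the torus, keeps the coset of [D] and
   yields a representative [1 + v] with [v] still swapping [X] and [1 - X]. *)
pose v := (vb * y0 * va^-1)%g; pose w := (m * va^-1)%g.
have wE : gmx w = 1 + gmx v.
  by rewrite /w gmxM mE mulrDl -vaE gmxVr /v !gmxM vbE.
have vaX : gmx va^-1%g * X = X * gmx va^-1%g.
  by rewrite -!gmxM; have /cent1P -> : va^-1%g \in 'C[x0]%g by rewrite groupV.
have vbX : gmx vb * X = X * gmx vb by rewrite -!gmxM; have /cent1P -> := vbC.
have vX : gmx v * X = (1 - X) * gmx v.
  rewrite /v !gmxM -mulrA vaX mulrA -(mulrA _ Y0) Y0X mulrA (comm_one_sub vbX).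
  by rewrite !mulrA.
have [eta eta0 v2] := swap_sqr_scalar vX.
have nX : X <> (1 - X).
  have -> : 1 - X = cx X (1, -1) by rewrite /cx /= scale1r scaleN1r.
  have {1}-> : X = cx X (0, 1) by rewrite /cx scale0r scale1r add0r.
  by case/(cx_inj X2 irr_d) => /eqP; rewrite eq_sym oner_eq0.
(* Otherwise [(1 - v)(1 + v) = 0] with [1 + v] invertible, so [v = 1] would commute with [X]. *)
have eta1 : eta != 1.
  apply/eqP => eta1; have v1 : 1 = gmx v.
    apply/eqP; rewrite -subr_eq0; apply/eqP; apply: (@gmx_rreg _ w).
    rewrite mul0r wE mulrDr mulr1 mulrBl mul1r -expr2 v2 eta1 scale1r.
    by rewrite addrA subrK subrr.
  by apply: nX; move: vX; rewrite -v1 mul1r mulr1.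
have vD : pcl v \in D.
  by rewrite /v !pclM pclV !(groupM, groupV) // (subsetP sTD) // mem_quotient.
have vT : pcl v \notin ('C[x0] / Z)%g.
  apply/negP => /morphimP[u _ /cent1P uC /pcl_eq[c vu]]; apply: nX.
  apply: (@gmx_rreg _ v); rewrite -vX vu -scalerAl -scalerAr; congr (_ *: _).
  by rewrite -!gmxM uC.
rewrite -(card_translate (fun h => pcl m * h \in nonsplit F)%g (x := pcl va^-1%g)); last first.
  by rewrite pclV groupV (subsetP sTD) // mem_quotient.
under eq_finset => h do rewrite mulgA -pclM -/w.
rewrite (card_index2 _ sTD oD vD vT) (card_torus_coset X2 irr_d vX v2 eta0 wE).
under eq_finset => h do rewrite mulgA -pclM.
rewrite -(nrootless_add_inv irr_d eta0 eta1); congr (_ + _)%N.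
have wvE : gmx (w * v)%g = eta *: (1 + eta^-1 *: gmx v).
  by rewrite gmxM wE mulrDl mul1r -expr2 v2 scalerDr scalerA mulfV // scale1r addrC.
have [w' w'E] : exists w', gmx w' = 1 + eta^-1 *: gmx v.
  apply: (@gmx_lift _ _ (eta *: gmx (w * v)^-1%g)).
  rewrite -[X in _ * X]scale1r -(mulVf eta0) -scalerA -wvE -scalerAl -scalerAr scalerA.
  by rewrite mulfV // scale1r gmxV.
have -> : pcl (w * v)%g = pcl w' by apply/pcl_eq; exists eta; rewrite w'E -wvE.
apply: (card_torus_coset X2 irr_d _ _ _ w'E).
- by rewrite -scalerAl vX scalerAr.
- by rewrite exprZn v2 scalerA expr2 -mulrA mulVf ?mulr1.
by rewrite invr_eq0.
Qed.

End TorusNormaliser.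

Local Close Scope ring_scope.

Theorem theorem1p1 (F : finFieldType) (q : nat)
    (D : {group coset_of (GLscalar 2 F)}) :
  #|F| = q ->
  D \subset PGL 2 F ->
  D \isog 'D_(2 * (q + 1)) ->
  covers_exactly
    [set g in PGL 2 F | (g ^+ (q + 1) == 1) && (g ^+ 2 != 1)]
    D
    (if odd q then q - 1 else q)%N
    (PGL 2 F).
Proof.
move=> <- sDG; have q1 := finNzRing_gt1 F; rewrite addn1.
case/dihedral_generators; first exact: ltnW.
move=> x [y [ox sxD oD /setDP[yD yx] [y2 xy]]] g gG.
have -> : [set h in PGL 2 F | (h ^+ #|F|.+1 == 1) && (h ^+ 2 != 1)] = nonsplit F.
  by rewrite -(addn1 #|F|).
rewrite card_factorisations.
have xq h : h \in <[x]> -> h ^+ (#|F| + 1) = 1.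
  by move/order_dvdG => hx; apply/eqP; rewrite -order_dvdn addn1 -ox.
have [gD | gD] := boolP (g \in D).
  rewrite (card_translate (fun h => h \in nonsplit F) gD).
  rewrite (card_index2 _ sxD _ yD yx) -?orderE ?ox //.
  (* Elements of [D] outside the cyclic half square to 1. *)
  have -> : [set h in <[x]> | y * h \in nonsplit F] = set0.
    apply/setP => h; rewrite !inE; apply/negP => /and3P[hx _ /andP[_ /eqP[]]].
    have hy : h ^ y = h^-1 by case/cycleP: hx => i ->; rewrite conjXg xy expgVn.
    have yV : y^-1 = y by apply/eqP; rewrite eq_invg_mul -y2 expgS expg1.
    by rewrite expgS expg1 mulgA -{1}yV -(mulgA y^-1) -conjgE hy mulVg.
  have -> : [set h in <[x]> | h \in nonsplit F] = <[x]> :\: [set h in <[x]> | h ^+ 2 == 1].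
    apply/setP => h; rewrite !inE negb_and; have [hx|] //= := boolP (h \in <[x]>).
    by rewrite xq // eqxx (subsetP sDG) ?andbT // (subsetP sxD).
  rewrite cards0 addn0 cardsD (setIidPr _); last by apply/subsetP => h; rewrite inE => /andP[].
  (* Of the [q + 1] elements of the cyclic half, those squaring to 1 are removed: two for [q] odd,
     one for [q] even. *)
  rewrite card_cycle_sqr1 -orderE ox /= negbK; case: (odd _) => /=; lia.
have [x1 x1E] := pcl_lift x; have [y0 y0E] := pcl_lift y.
have [t [d x1_2]] := mx2_quad (gmx x1).
(* The generator [x] has order [q + 1 > 2], so it lies in [A] and has a lift generating a quadratic
   field. *)
have x1_ns : pcl x1 \in nonsplit F.
  rewrite inE pcl_PGL -x1E xq ?cycle_id // eqxx -order_dvdn ox /=.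
  by apply/negP => /(dvdn_leq (ltn0Sn 1)); rewrite ltnS leqNgt q1.
have x1n1 : pcl x1 <> 1 by rewrite -x1E => xE1; move: ox q1; rewrite xE1 order1 => -[<-].
have [t0 irr] := (mem_nonsplit x1_2 x1n1).1 x1_ns.
have [x0 [d' [x01 X2 irr_d]]] := quad_normalize t0 x1_2 irr.
rewrite x1E -x01 in xy ox sxD yx.
(* One inclusion is clear, and both groups have order [q + 1]. *)
have Tx : 'C[x0] / GLscalar 2 F = <[pcl x0]>.
  apply/esym/eqP; rewrite eqEcard cycle_subG mem_quotient ?cent1id //=.
  by rewrite (card_cent_PGL X2 irr_d) -orderE ox.
have Y0X : (gmx y0 * gmx x0 = (1 - gmx x0) * gmx y0)%R.
  by apply: (conj_inverse_swaps X2 irr_d); rewrite -y0E.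
apply: (card_nonsplit_coset X2 irr_d Y0X) => //.
- by rewrite Tx.
- by rewrite Tx -orderE ox.
by rewrite -y0E.
Qed.
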